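(* Let $R$ be a commutative ring with nonzero identity. (i) If $M$ is a pseudo simple $R$-module, then each submodule of $M$ is a pseudo simple $R$-module. (ii) If $M$ is a pseudo simple $R$-module, then each factor module of $M$ by a submodule is a pseudo simple $R$-module. (iii) Let $\{M_i\}_{i\in I}$ be a family of $R$-modules such that $\bigoplus_{i}M_i$ or $\prod_i M_i$ is a pseudo simple $R$-module. Then each $M_i$ is a pseudo simple $R$-module.
   Context: For a commutative ring $R$ with nonzero identity (not necessarily a domain), an $R$-module $M$ is called pseudo simple if the submodule $Rm$ is simple for every $0\neq m\in M$ with $Rm\neq M$. *)

(* Defs.v *)
From HB Require Import structures.
From mathcomp Require Import all_boot all_algebra.
From mathcomp Require Import boolp classical_sets functions cardinality.

Set Implicit Arguments.
Unset Strict Implicit.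
Unset Printing Implicit Defensive.

Import GRing.Theory.
Local Open Scope ring_scope.
Local Open Scope quotient_scope.

(* Submodules of M are the boolean predicates [N : submodClosed M].  As
   [asbool] turns any Prop-valued predicate into a boolean one, these are all
   the submodules, not only the decidable ones. *)

Section Submod.
Variables (R : pzRingType) (M : lmodType R) (N : submodClosed M).

Record submod : Type := Submod { submod_val :> M; submod_valP : submod_val \in N }.

HB.instance Definition _ := [isSub for submod_val].
HB.instance Definition _ := [Choice of submod by <:].
HB.instance Definition _ := [SubChoice_isSubLmodule of submod by <:].
End Submod.

Section QuotientModule.
Variables (R : pzRingType) (M : lmodType R) (N : submodClosed M).

Lemma submod_zmod_closed : zmod_closed N.
Proof.
split=> [|x y Nx Ny]; first exact: rpred0.
by rewrite rpredD // -scaleN1r rpredZ.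
Qed.

Definition submod_zmodClosed : zmodClosed M :=
  HB.pack_for (zmodClosed M) (GRing.SubmodClosed.sort N)
    (GRing.isZmodClosed.Build M (GRing.SubmodClosed.sort N) submod_zmod_closed).

Definition quotmod : Type := Quotient.quot submod_zmodClosed.

HB.instance Definition _ := GRing.Zmodule.on quotmod.
HB.instance Definition _ :=
  EqQuotient.copy quotmod (Quotient.quot submod_zmodClosed).

Definition quotmod_scale (a : R) (x : quotmod) : quotmod :=
  \pi_quotmod (a *: repr x).

Lemma quotmod_eqE (x y : M) : (x == y %[mod quotmod]) = (x - y \in N).
Proof. by rewrite -(Quotient.idealrBE submod_zmodClosed). Qed.

Lemma quotmod_piD (x y : M) :
  \pi_quotmod (x + y) = (\pi_quotmod x : quotmod) + \pi_quotmod y.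
Proof. exact: (Quotient.pi_add submod_zmodClosed). Qed.

Lemma quotmod_piZ a (x : M) :
  \pi_quotmod (a *: x) = quotmod_scale a (\pi_quotmod x).
Proof.
apply/eqP; rewrite quotmod_eqE -scalerBr rpredZ // -quotmod_eqE.
by rewrite reprK.
Qed.

Lemma quotmod_scaleA a b x :
  quotmod_scale a (quotmod_scale b x) = quotmod_scale (a * b) x.
Proof.
rewrite -[x]reprK -[quotmod_scale b _]quotmod_piZ -[LHS]quotmod_piZ.
by rewrite -[RHS]quotmod_piZ scalerA.
Qed.

Lemma quotmod_scale1 : left_id 1 quotmod_scale.
Proof. by move=> x; rewrite -[x]reprK -quotmod_piZ scale1r. Qed.

Lemma quotmod_scaleDr : right_distributive quotmod_scale +%R.
Proof.
move=> a x y; rewrite -[x]reprK -[y]reprK -quotmod_piD.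
by rewrite -[LHS]quotmod_piZ scalerDr quotmod_piD !quotmod_piZ.
Qed.

Lemma quotmod_scaleDl x : {morph quotmod_scale^~ x : a b / a + b}.
Proof.
move=> a b; rewrite -[x]reprK.
by rewrite -[LHS]quotmod_piZ scalerDl quotmod_piD !quotmod_piZ.
Qed.

HB.instance Definition _ := GRing.Zmodule_isLmodule.Build R quotmod
  quotmod_scaleA quotmod_scale1 quotmod_scaleDr quotmod_scaleDl.

End QuotientModule.

Definition prodmod (R : pzRingType) (I : Type) (M : I -> lmodType R) : Type :=
  forall i, M i.

Section ProductModule.
Variables (R : pzRingType) (I : Type) (M : I -> lmodType R).
Implicit Types f g h : prodmod M.

HB.instance Definition _ := Choice.copy (prodmod M) (forall i, M i).

Definition prodmod_add f g : prodmod M := fun i => f i + g i.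
Definition prodmod_opp f : prodmod M := fun i => - f i.
Definition prodmod_zero : prodmod M := fun=> 0.
Definition prodmod_scale (a : R) f : prodmod M := fun i => a *: f i.

Lemma prodmod_addA : associative prodmod_add.
Proof. by move=> f g h; apply: functional_extensionality_dep => i; apply: addrA. Qed.
Lemma prodmod_addC : commutative prodmod_add.
Proof. by move=> f g; apply: functional_extensionality_dep => i; apply: addrC. Qed.
Lemma prodmod_add0 : left_id prodmod_zero prodmod_add.
Proof. by move=> f; apply: functional_extensionality_dep => i; apply: add0r. Qed.
Lemma prodmod_addN : left_inverse prodmod_zero prodmod_opp prodmod_add.
Proof. by move=> f; apply: functional_extensionality_dep => i; apply: addNr. Qed.

HB.instance Definition _ := GRing.isZmodule.Build (prodmod M)
  prodmod_addA prodmod_addC prodmod_add0 prodmod_addN.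

Lemma prodmod_scaleA a b f :
  prodmod_scale a (prodmod_scale b f) = prodmod_scale (a * b) f.
Proof. by apply: functional_extensionality_dep => i; apply: scalerA. Qed.
Lemma prodmod_scale1 : left_id 1 prodmod_scale.
Proof. by move=> f; apply: functional_extensionality_dep => i; apply: scale1r. Qed.
Lemma prodmod_scaleDr : right_distributive prodmod_scale +%R.
Proof. by move=> a f g; apply: functional_extensionality_dep => i; apply: scalerDr. Qed.
Lemma prodmod_scaleDl f : {morph prodmod_scale^~ f : a b / a + b}.
Proof. by move=> a b; apply: functional_extensionality_dep => i; apply: scalerDl. Qed.

HB.instance Definition _ := GRing.Zmodule_isLmodule.Build R (prodmod M)
  prodmod_scaleA prodmod_scale1 prodmod_scaleDr prodmod_scaleDl.

Definition finsupp : {pred prodmod M} :=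
  fun f => `[< finite_set [set i | f i != 0]%classic >].

Lemma finsupp_subsemimod_closed : subsemimod_closed finsupp.
Proof.
split; first split.
- apply/asboolP; rewrite (_ : [set i | _]%classic = set0) //.
  by apply/seteqP; split=> i //=; rewrite eqxx.
- move=> f g /asboolP ff /asboolP fg; apply/asboolP.
  have ffg : finite_set ([set i | f i != 0] `|` [set i | g i != 0])%classic.
    by rewrite finite_setU.
  apply: sub_finite_set ffg => i /= fgi.
  have [fi|] := eqVneq (f i) 0; [right | by left].
  by apply: contra_neq fgi => gi; rewrite /GRing.add /= /prodmod_add fi gi addr0.
- move=> a f /asboolP ff; apply/asboolP; apply: sub_finite_set ff => i /=.
  by apply: contra_neq => fi; rewrite /GRing.scale /= /prodmod_scale fi scaler0.
Qed.

HB.instance Definition _ :=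
  GRing.isSubmodClosed.Build R (prodmod M) finsupp finsupp_subsemimod_closed.

End ProductModule.

Arguments finsupp {R I} M.

Definition dirsum (R : pzRingType) (I : Type) (M : I -> lmodType R)
    : lmodType R :=
  submod (finsupp M).

Section PseudoSimple.
Variables (R : pzRingType) (M : lmodType R).

Definition cyclic_submod (m : M) : {pred M} :=
  fun x => `[< exists r : R, x = r *: m >].

Lemma cyclic_submod_closed m : subsemimod_closed (cyclic_submod m).
Proof.
split; first split.
- by apply/asboolP; exists 0; rewrite scale0r.
- move=> x y /asboolP[r ->] /asboolP[s ->]; apply/asboolP; exists (r + s).
  by rewrite scalerDl.
- move=> a x /asboolP[r ->]; apply/asboolP; exists (a * r).
  by rewrite scalerA.
Qed.

HB.instance Definition _ m :=
  GRing.isSubmodClosed.Build R M (cyclic_submod m) (cyclic_submod_closed m).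

Definition simple_module : Prop :=
  (exists x : M, x <> 0) /\
  forall N : submodClosed M,
    (forall x : M, x \in N -> x = 0) \/ (forall x : M, x \in N).

End PseudoSimple.

Definition pseudo_simple (R : pzRingType) (M : lmodType R) : Prop :=
  forall m : M, m <> 0 -> ~ (forall x : M, x \in cyclic_submod m) ->
    simple_module (submod (cyclic_submod m)).

(* Main.v *)
(* A cyclic module Rm is simple iff m is nonzero and lies in R(rm) whenever
   rm is nonzero.  In this form pseudo simplicity pulls back along injective
   and pushes forward along surjective linear maps, the direct sum embeds
   in the product, and M_i is the image of the direct sum under the i-th
   projection. *)
Require Import Defs.
From mathcomp Require Import all_boot all_algebra.
From mathcomp Require Import boolp classical_sets cardinality.

Set Implicit Arguments.
Unset Strict Implicit.
Unset Printing Implicit Defensive.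

Import GRing.Theory.
Local Open Scope ring_scope.
Local Open Scope quotient_scope.

Section PseudoSimple.
Variable R : pzRingType.
Implicit Types M N : lmodType R.

Lemma cyclic_submod_id M (m : M) : m \in cyclic_submod m.
Proof. by apply/asboolP; exists 1; rewrite scale1r. Qed.

(** Forward, simplicity is applied to the submodule of [Rm] generated by [r *: m]. Backward, any
    nonzero element of a submodule of [Rm] already generates [m]. *)
Lemma simple_cyclicP M (m : M) :
  simple_module (submod (cyclic_submod m)) <->
  m <> 0 /\ forall r : R, r *: m <> 0 -> m \in cyclic_submod (r *: m).
Proof.
split=> [[[x x0] simpM]|[m0 genm]].
- split=> [m0|r rm0].
    apply/x0/val_inj => /=; have /asboolP[r ->] := submod_valP x.
    by rewrite m0 scaler0.
  pose g : submod (cyclic_submod m) := Submod (cyclic_submod_id m).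
  case: (simpM (cyclic_submod (r *: g))) => [zero|full].
    by case: rm0; have /(congr1 \val) := zero _ (cyclic_submod_id (r *: g)).
  by have /asboolP[s /(congr1 \val) eg] := full g; apply/asboolP; exists s.
- split; first by exists (Submod (cyclic_submod_id m)) => /(congr1 \val).
  move=> K; case: (pselect (forall x, x \in K -> x = 0)) => [|nz]; first by left.
  right=> y; have [x [Kx x0]] : exists x, x \in K /\ x <> 0.
    apply: contrapT => nex; apply: nz => x Kx.
    by apply: contrapT => x0; apply: nex; exists x.
  have /asboolP[r xE] := submod_valP x.
  have /asboolP[t yE] := submod_valP y.
  have /genm/asboolP[s mE] : r *: m <> 0.
    by rewrite -xE => x00; apply/x0/val_inj.
  (* Here [x = r *: m], [y = t *: m] and [m = s *: (r *: m) = s *: x]. *)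
  suff -> : y = (t * s) *: x by rewrite rpredZ.
  by apply: val_inj; rewrite /= yE {1}mE -xE scalerA.
Qed.

(** Injectivity reflects membership: [f x] in [R(f m)] forces [x] in [Rm]. So [R(f m)] is proper
    when [Rm] is, and the criterion for [f m] descends to [m]. *)
Lemma pseudo_simple_inj M N (f : M -> N) :
  scalable f -> injective f -> pseudo_simple N -> pseudo_simple M.
Proof.
move=> fZ fI psN m m0 mT; apply/simple_cyclicP; split=> // r rm0.
have f0 : f 0 = 0 by rewrite -(scale0r 0) fZ scale0r.
have fm0 : f m <> 0 by rewrite -f0 => /fI.
have fmT : ~ forall x, x \in cyclic_submod (f m).
  move=> full; apply: mT => x; have /asboolP[s fx] := full (f x).
  by apply/asboolP; exists s; apply: fI; rewrite fZ.
have /simple_cyclicP[_ /(_ r)] := psN _ fm0 fmT.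
rewrite -fZ -f0 => /(_ (fun e => rm0 (fI _ _ e)))/asboolP[s].
by rewrite -fZ => /fI ms; apply/asboolP; exists s.
Qed.

(** A preimage [m] of a generator works: [Rm = M] would give [R(f m) = N], and a relation
    [m = s *: (r *: m)] is carried over by [f]. *)
Lemma pseudo_simple_surj M N (f : M -> N) :
  scalable f -> (forall y, exists x, f x = y) ->
  pseudo_simple M -> pseudo_simple N.
Proof.
move=> fZ fS psM y; have [m <-] := fS y => fm0 fmT.
have f0 : f 0 = 0 by rewrite -(scale0r 0) fZ scale0r.
have m0 : m <> 0 by move=> m0; apply: fm0; rewrite m0.
have mT : ~ forall x, x \in cyclic_submod m.
  move=> full; apply: fmT => z; have [x <-] := fS z.
  by have /asboolP[s ->] := full x; apply/asboolP; exists s; rewrite fZ.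
have /simple_cyclicP[_ genm] := psM _ m0 mT.
apply/simple_cyclicP; split=> // r; rewrite -fZ => frm0.
have /genm/asboolP[s mE] : r *: m <> 0 by move=> rm0; apply: frm0; rewrite rm0.
by apply/asboolP; exists s; rewrite -fZ -mE.
Qed.

Lemma dirsum_proj_surj (I : Type) (M : I -> lmodType R) (i : I) (y : M i) :
  exists x : dirsum M, submod_val x i = y.
Proof.
(* The family supported at [i] alone: [y] is transported along [i = j], with value 0 at every other
   index. *)
pose f : prodmod M := fun j =>
  if pselect (i = j) is left e then eq_rect i (fun k => M k : Type) y j e else 0.
have fi : f i = y.
  (* Proof irrelevance turns the transport along [e : i = i] into the identity. *)
  by rewrite /f; case: pselect => // e; rewrite (Prop_irrelevance e erefl).
have ff : f \in finsupp M.
  apply/asboolP; apply: (sub_finite_set _ (finite_set1 i)) => j /=.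
  by rewrite /f; case: pselect => [e _|_]; rewrite ?eqxx ?e.
by exists (Submod ff).
Qed.

End PseudoSimple.

Theorem corollary2 (R : comNzRingType) :
  (forall M : lmodType R, pseudo_simple M ->
     forall N : submodClosed M, pseudo_simple (submod N)) /\
  (forall M : lmodType R, pseudo_simple M ->
     forall N : submodClosed M, pseudo_simple (quotmod N)) /\
  (forall (I : Type) (M : I -> lmodType R),
     pseudo_simple (dirsum M) \/ pseudo_simple (prodmod M) ->
     forall i : I, pseudo_simple (M i)).
Proof.
have dirsum_prod I (M : I -> lmodType R) :
    pseudo_simple (prodmod M) -> pseudo_simple (dirsum M).
  exact: (@pseudo_simple_inj _ (dirsum M) _ (@submod_val _ _ _) _ val_inj).
split=> [M psM N|].
  exact: (@pseudo_simple_inj _ _ _ (@submod_val _ _ N) _ val_inj).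
split=> [M psM N|I M psM i].
  apply: (@pseudo_simple_surj _ _ _ (\pi_(quotmod N))) psM => [a x|y].
    exact: quotmod_piZ.
  by exists (repr y); rewrite reprK.
(* Both alternatives reduce to the direct sum, so one projection argument covers them. *)
have : pseudo_simple (dirsum M) by case: psM => // /dirsum_prod.
apply: (@pseudo_simple_surj _ _ _ (fun x : dirsum M => submod_val x i)) => //.
exact: dirsum_proj_surj.
Qed.
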